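(* Let $G$ be a finite transitive permutation group on a finite set $\Omega$, and let $N=D(G)$ be the (normal) subgroup of $G$ generated by the derangements in $G$. Then: (a) $N$ is transitive on $\Omega$. (b) $N$ contains every element of $G$ whose number of fixed points in $\Omega$ is different from $1$. (c) If $r_G$ and $r_N$ denote the permutation ranks of $G$ and $N$ on $\Omega$, then $r_N-1=(r_G-1)\,|G:N|$. (d) The $N$-orbits on ordered pairs of distinct elements of $\Omega$ are permuted semiregularly by $G/N$; equivalently, for $\alpha\in\Omega$, the $N_\alpha$-orbits on $\Omega$ different from $\{\alpha\}$ are permuted semiregularly by $G_\alpha/N_\alpha$.
   Context: A derangement is a permutation with no fixed points. The permutation rank of a transitive group $X$ on $\Omega$ is the number of orbits of $X$ on $\Omega\times\Omega$. $X_\alpha$ denotes the stabiliser of $\alpha$ in $X$. An action is semiregular if only the identity element of the acting group fixes a point (here, the ''points'' are the orbits being permuted). Since $N$ is normal in $G$, $G/N$ acts on the set of $N$-orbits on ordered pairs of distinct elements of $\Omega$, and $G_\alpha/N_\alpha$ acts on the set of $N_\alpha$-orbits. *)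

(* Defs.v *)
From mathcomp Require Import all_boot all_fingroup all_solvable.

Set Implicit Arguments.
Unset Strict Implicit.
Unset Printing Implicit Defensive.

Local Open Scope group_scope.

Section Definitions.

Variable T : finType.
Implicit Types G X : {group {perm T}}.

Definition derangements G : {set {perm T}} :=
  [set g in G | 'Fix_'P[g] == set0].

Definition derangement_subgroup G : {group {perm T}} := <<derangements G>>%G.

(* ['P * 2] is the diagonal action on the set of all ordered pairs, with pairs
   represented as 2-tuples. *)
Definition permutation_rank X : nat :=
  #|orbit ('P * 2) X @: [set: 2.-tuple T]|.

End Definitions.

Definition semiregular_on (aT : finGroupType) (D : {set aT}) (rT : finType)
    (to : action D rT) (A : {set aT}) (S : {set rT}) : Prop :=
  [acts A, on S | to] /\ {in S & A, forall x a, to x a = x -> a = 1}.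

(* The mathcomp quotient [A / H] and induced action [to %% H] are total: the
   former only sees the part of [A] normalising [H], the latter acts trivially
   off the fixed points of [H]. The next three lemmas check that neither
   convention interferes in the cases of interest. *)
Lemma derangement_subgroup_normal (T : finType) (G : {group {perm T}}) :
  derangement_subgroup G <| G.
Proof.
rewrite /normal gen_subG; apply/andP; split.
  by apply/subsetP => g; rewrite inE => /andP[].
apply: norms_gen; apply/subsetP => h Gh; rewrite inE.
apply/subsetP => _ /imsetP[g /[!inE] /andP[Gg /eqP g0] ->].
rewrite groupJ //=; apply/eqP/setP => x; rewrite !inE.
apply/negbTE/negP; rewrite sub1set inE => /eqP gx.
have: h^-1 x \in 'Fix_'P[g].
  apply/afix1P; rewrite /= /aperm; move: gx; rewrite /= /aperm !permM => gx.
  by apply: (@perm_inj _ h); rewrite gx permKV.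
by rewrite g0 inE.
Qed.

Lemma stab_normal (T : finType) (G N : {group {perm T}}) (a : T) :
  N <| G -> 'C_N[a | 'P] <| 'C_G[a | 'P].
Proof.
move=> nNG; have sNG := normal_sub nNG.
have -> : 'C_N[a | 'P] = 'C_G[a | 'P] :&: N by rewrite setIAC (setIidPr sNG).
exact: normalGI (subsetIl _ _) nNG.
Qed.

Lemma quotient_act_orbit (aT : finGroupType) (rT : finType)
    (to : {action aT &-> rT}) (G H : {group aT}) (x : rT) (g : aT) :
  H <| G -> g \in G ->
  (to^* %% H)%act (orbit to H x) (coset H g) = orbit to H (to x g).
Proof.
move=> /andP[_ nHG] Gg; have nHg := subsetP nHG g Gg.
rewrite /= modactE ?in_setT //=; first by rewrite setact_orbit (normP nHg).
apply/afixP => h /setIP[_ Hh].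
by rewrite /= setact_orbit conjGid // (orbit_act to x Hh).
Qed.

(* Main.v *)
(** Burnside's count over [G] gives fixed-point average 1, while every element of
    [G] outside [N] has at least one fixed point; hence [N] has average at most 1,
    which forces [N] to be transitive and every element of [G] outside [N] to fix
    exactly one point.  Counting fixed ordered pairs over [G] and over [N] then
    relates the two ranks, and an element fixing the [N]-orbit of a pair of
    distinct points agrees modulo [N] with one fixing the pair itself, hence
    lies in [N]. *)
Require Import Defs.
From mathcomp Require Import all_boot all_fingroup all_solvable.

Set Implicit Arguments.
Unset Strict Implicit.
Unset Printing Implicit Defensive.

Local Open Scope group_scope.

Section TotalAction.

Variables (aT : finGroupType) (rT : finType) (to : {action aT &-> rT}).
Implicit Types (A H K : {group aT}) (S : {set rT}).

Lemma sum_card_afix1 A :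
  (\sum_(g in A) #|'Fix_to[g]| = #|orbit to A @: [set: rT]| * #|A|)%N.
Proof.
rewrite -(@Frobenius_Cauchy _ _ _ to A [set: rT]).
  by apply: eq_bigr => g _; rewrite setTI.
by apply/actsP=> g _ x; rewrite !inE.
Qed.

(** Lets transitivity enter and leave Burnside's count as a numerical equality. *)
Lemma card_orbits_atrans A :
  [transitive A, on [set: rT] | to] = (#|orbit to A @: [set: rT]| == 1%N).
Proof.
apply/idP/cards1P=> [trA | [O defO]].
  case/imsetP: (trA) => x _ defO; exists [set: rT].
  apply/setP=> O; apply/imsetP/set1P=> [[y _ ->] | ->].
    by rewrite (atransP trA).
  by exists x.
have orbE y : orbit to A y = O.
  by apply/set1P; rewrite -defO imset_f.
have /imsetP[x _ _]: O \in orbit to A @: [set: rT] by rewrite defO set11.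
apply/imsetP; exists x => //; apply/setP=> y.
by rewrite inE orbE -(orbE y) orbit_refl.
Qed.

(** Common core of both halves of (d). If [g] fixes the [H]-orbit of [x], some [h] in [H] brings
    [to x g] back to [x]; then [g * h] fixes [x], so it lies in [H], and so does [g]. *)
Lemma semiregular_on_quotient_orbits H K S :
    H <| K -> [acts K, on S | to] ->
    {in S & K, forall x g, to x g = x -> g \in H} ->
  semiregular_on (to^* %% H)%act (K / H) (orbit to H @: S).
Proof.
move=> nHK actsS freeS; split=> [|_ _ /imsetP[x Sx ->] /morphimP[g _ Kg ->]].
  (* The side condition holds because [H] fixes each of its own orbits. *)
  rewrite astabs_mod; last first.
    apply/subsetP=> h Hh; rewrite !inE; apply/subsetP=> _ /imsetP[x _ ->].
    by rewrite !inE /= setact_orbit conjGid // (orbit_act to x Hh).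
  apply: quotientS; apply/actsP=> g Kg O.
  have sub h P : h \in K -> P \in orbit to H @: S ->
      to^*%act P h \in orbit to H @: S.
    move=> Kh /imsetP[x Sx ->]; rewrite /= setact_orbit.
    rewrite (normP (subsetP (normal_norm nHK) h Kh)).
    by rewrite imset_f ?(acts_act actsS).
  apply/idP/idP=> [/(sub _ _ (groupVr Kg))|]; last exact: sub.
  by rewrite actK.
rewrite (quotient_act_orbit _ _ nHK Kg) => /esym/orbit_eqP/orbitP[h Hh xh].
have Kh := subsetP (normal_sub nHK) h Hh.
apply/coset_id; rewrite -(groupMr g Hh).
by apply: freeS Sx _ _; rewrite ?groupM // actM.
Qed.

End TotalAction.

(** A pair is fixed exactly when both its coordinates are. *)
Lemma afix1_pairE (T : finType) (g : {perm T}) (x : T) :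
  'Fix_'P[g] = [set x] -> afix ('P * 2) [set g] = [set [tuple x; x]].
Proof.
move=> Fg; have memF z : (z \in [set x]) = (aperm z g == z).
  by rewrite -Fg; apply/afix1P/eqP.
apply/setP=> t; case: (tupleP t) => y u; case: (tupleP u) => z v.
rewrite (sameP afix1P eqP) inE -!val_eqE /= (tuple0 v) /= !eqseq_cons.
by rewrite eqxx !andbT -!memF !inE.
Qed.

Section DerangementSubgroup.

Variables (T : finType) (G : {group {perm T}}).
Hypothesis Gtrans : [transitive G, on [set: T] | 'P].

Local Notation N := (derangement_subgroup G).

Lemma derangement_subgroup_sub : N \subset G.
Proof. exact: normal_sub (derangement_subgroup_normal G). Qed.
Local Notation sNG := derangement_subgroup_sub.

Lemma card_afix1_gt0 g : g \in G :\: N -> (0 < #|'Fix_'P[g]|)%N.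
Proof.
case/setDP=> Gg; apply: contraR; rewrite -leqNgt leqn0 cards_eq0 => Fg0.
by rewrite mem_gen // inE Gg.
Qed.

Lemma sum_derangement_subgroupD (F : {perm T} -> nat) :
  (\sum_(g in G) F g = \sum_(g in N) F g + \sum_(g in G :\: N) F g)%N.
Proof. by rewrite (big_setID N) /= (setIidPr sNG). Qed.

Lemma derangement_subgroup_counts :
  #|orbit 'P N @: [set: T]| = 1%N
  /\ {in G :\: N, forall g, #|'Fix_'P[g]| = 1%N}.
Proof.
have := sum_card_afix1 'P G; rewrite sum_derangement_subgroupD sum_card_afix1.
move: (Gtrans); rewrite card_orbits_atrans => /eqP->; rewrite mul1n.
set k := #|orbit 'P N @: _|; have k_gt0: (0 < k)%N.
  case/imsetP: Gtrans => x _ _.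
  by apply/card_gt0P; exists (orbit 'P N x); apply: imset_f.
(* With [k] the number of [N]-orbits, Burnside reads [|G| = k|N| + sum of |Fix g| over G :\: N]. The
   two summands are at least [|N|] and [|G :\: N|], whose sum is [|G|], so both bounds, and every
   termwise bound, are equalities. *)
have leifN := leqif_eq (leq_pmull #|N| k_gt0).
have leifD := leqif_sum (fun g DNg => leqif_eq (@card_afix1_gt0 g DNg)).
have [_] := leqif_add leifN leifD.
rewrite sum1_card -(cardsID N G) (setIidPr sNG) => eqC /esym eqS.
move: eqC; rewrite eqS eqxx => /esym/andP[/eqP eqN /forall_inP fix1].
split; first by apply/eqP; rewrite -(eqn_pmul2r (cardG_gt0 N)) mul1n -eqN.
by move=> g DNg; apply/esym/eqP/fix1.
Qed.

Lemma derangement_subgroup_trans : [transitive N, on [set: T] | 'P].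
Proof.
by rewrite card_orbits_atrans; apply/eqP; case: derangement_subgroup_counts.
Qed.

Lemma mem_derangement_subgroup g :
  g \in G -> #|'Fix_'P[g]| != 1%N -> g \in N.
Proof.
move=> Gg; apply: contraR => notNg; apply/eqP.
by case: derangement_subgroup_counts => _; apply; rewrite inE notNg.
Qed.

Lemma mem_derangement_subgroup_fix2 g x y :
  g \in G -> x != y -> 'P%act x g = x -> 'P%act y g = y -> g \in N.
Proof.
move=> Gg neq_xy xg yg; apply: mem_derangement_subgroup Gg _.
apply: contra neq_xy => /cards1P[z Fg].
have /set1P->: x \in [set z] by rewrite -Fg; apply/afix1P.
by have /set1P->: y \in [set z] by rewrite -Fg; apply/afix1P.
Qed.

(** Counting fixed pairs gives [r_G |G| = r_N |N| + |G :\: N|], since each element outside [N] fixes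
    a single pair. Subtracting [|G| = |N| + |G :\: N|] and cancelling [|N|] yields the claim. *)
Lemma permutation_rank_derangement_subgroup :
  (permutation_rank N - 1 = (permutation_rank G - 1) * #|G : N|)%N.
Proof.
have := sum_card_afix1 ('P * 2) G.
rewrite sum_derangement_subgroupD sum_card_afix1 -!/(permutation_rank _).
rewrite [X in (_ + X)%N](_ : _ = #|G :\: N|); last first.
  rewrite -sum1_card; apply: eq_bigr => g GNg.
  have [_ fix1] := derangement_subgroup_counts.
  by have /eqP/cards1P[x /afix1_pairE->] := fix1 g GNg; rewrite cards1.
rewrite -(Lagrange sNG) => eq_r.
have eq_d := cardsID N G; rewrite (setIidPr sNG) -(Lagrange sNG) in eq_d.
apply/eqP; rewrite -(eqn_pmul2r (cardG_gt0 N)); apply/eqP.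
rewrite -mulnA (mulnC #|G : N|) !mulnBl !mul1n.
(* Adding [|G :\: N|] to both terms of a truncated difference leaves it unchanged. *)
by rewrite -(subnDr #|G :\: N|) eq_d -eq_r.
Qed.

End DerangementSubgroup.

Theorem theorem1p1 (T : finType) (G : {group {perm T}})
    (Gtrans : [transitive G, on [set: T] | 'P]) :
  let N := derangement_subgroup G in
  [/\ (* (a) *)
      [transitive N, on [set: T] | 'P],
      (* (b) *)
      forall g : {perm T}, g \in G -> #|'Fix_'P[g]| != 1%N -> g \in N,
      (* (c) *)
      (permutation_rank N - 1 = (permutation_rank G - 1) * #|G : N|)%N
    & (* (d) *)
      semiregular_on (('P * 2)^* %% N)%act (G / N)
        (orbit ('P * 2) N @: 2.-dtuple([set: T]))
      /\ forall a : T,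
           semiregular_on ('P^* %% 'C_N[a | 'P])%act
             ('C_G[a | 'P] / 'C_N[a | 'P])
             ((orbit 'P 'C_N[a | 'P] @: [set: T]) :\ [set a])].
Proof.
move=> N; have nNG := derangement_subgroup_normal G.
split; [exact: derangement_subgroup_trans | exact: mem_derangement_subgroup
       | exact: permutation_rank_derangement_subgroup | split=> [|a]].
  apply: semiregular_on_quotient_orbits nNG _ _.
    apply/subsetP=> g Gg; rewrite !inE; apply/subsetP=> t dt; rewrite inE.
    by apply: n_act_dtuple dt; apply/astabsP=> x; rewrite !inE.
  move=> t g; case: (tupleP t) => x u; case: (tupleP u) => y v dt Gg.
  move/(congr1 val)=> /= [xg yg _].
  apply: (mem_derangement_subgroup_fix2 Gtrans Gg _ xg yg).
  by move: dt; rewrite !inE /= inE negb_or -!andbA => /andP[].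
(* As [a] is alone in its orbit, the remaining orbits are those of the points other than [a], the
   form the general lemma expects. *)
have -> : (orbit 'P 'C_N[a | 'P] @: [set: T]) :\ [set a]
          = orbit 'P 'C_N[a | 'P] @: [set~ a].
  have orba: orbit 'P 'C_N[a | 'P] a = [set a].
    by apply/orbit1P/afixP=> h /setIP[_ /astab1P].
  apply/setP=> O; apply/setD1P/imsetP=> [[neqOa /imsetP[x _ defO]] | [x]].
    exists x => //; rewrite !inE; apply: contraNneq neqOa => eq_xa.
    by rewrite defO eq_xa orba.
  rewrite !inE => neq_xa ->; split; last by rewrite imset_f.
  apply: contraNneq neq_xa => orbx.
  by rewrite -in_set1 -orbx orbit_refl.
apply: semiregular_on_quotient_orbits (stab_normal a nNG) _ _.
  apply/actsP=> g /setIP[_ /astab1P ag] x; rewrite !inE.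
  by rewrite -{1}ag (inj_eq (act_inj 'P g)).
(* Here [g] fixes the two distinct points [x] and [a], which puts it in [N]. *)
move=> x g; rewrite in_setC1 => neq_xa /setIP[Gg /astab1P ag] xg.
rewrite inE (mem_derangement_subgroup_fix2 Gtrans Gg neq_xa xg ag) /=.
exact/astab1P.
Qed.
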